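(* Let $X$ be an Archimedean vector lattice. Then $X$ admits a positively homogeneous continuous function calculus if and only if $X$ is finitely uniformly complete. When $X$ is finitely uniformly complete, the positively homogeneous continuous function calculus is unique, in the sense that for each $n\in\mathbb{N}$ and $\boldsymbol{x}=(x_1,\ldots,x_n)\in X^n$ there is only one vector lattice homomorphism $\Phi_{\boldsymbol{x}}\colon H_n\to X$ which satisfies $\Phi_{\boldsymbol{x}}(\pi_i^{(n)})=x_i$ for each $i\in\{1,\ldots,n\}$; and $$\Phi_{(\Phi_{\boldsymbol{x}}(f_1),\ldots,\Phi_{\boldsymbol{x}}(f_m))}(g)=\Phi_{\boldsymbol{x}}\bigl(g\circ(f_1\times\cdots\times f_m)\bigr)$$ for each $m,n\in\mathbb{N}$, $\boldsymbol{x}\in X^n$, $f_1,\ldots,f_m\in H_n$ and $g\in H_m$, where $f_1\times\cdots\times f_m\colon\mathbb{R}^n\to\mathbb{R}^m$ is the function defined by $(f_1\times\cdots\times f_m)(t)=\bigl(f_1(t),\ldots,f_m(t)\bigr)$ for $t\in\mathbb{R}^n$.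
   Context: All vector spaces and vector lattices are over $\mathbb{R}$, and $\mathbb{N}=\{1,2,\ldots\}$. Sublattices are linear sublattices (closed under linear operations and $\vee,\wedge$), and a vector lattice homomorphism is a linear map preserving $\vee$ and $\wedge$. A vector lattice $X$ is Archimedean if, whenever $x,y\in X^+$ satisfy $nx\le y$ for each $n\in\mathbb{N}$, it follows that $x=0$. A function $f\colon\mathbb{R}^n\to\mathbb{R}$ is positively homogeneous if $f(\lambda t)=\lambda f(t)$ for each $\lambda\in[0,\infty)$ and $t\in\mathbb{R}^n$. For $n\in\mathbb{N}$, $H_n$ denotes the vector lattice (with pointwise operations) of positively homogeneous, continuous functions $\mathbb{R}^n\to\mathbb{R}$, and $\pi_i^{(n)}\in H_n$ is the $i$-th coordinate projection $(t_1,\ldots,t_n)\mapsto t_i$. A vector lattice $X$ admits a positively homogeneous continuous function calculus if, for each $n\in\mathbb{N}$ and each $\boldsymbol{x}=(x_1,\ldots,x_n)\in X^n$, there is a vector lattice homomorphism $\Phi_{\boldsymbol{x}}\colon H_n\to X$ such that $\Phi_{\boldsymbol{x}}(\pi_i^{(n)})=x_i$ for $i\in\{1,\ldots,n\}$. In this case the map $\boldsymbol{x}\mapsto\Phi_{\boldsymbol{x}}$ is called a positively homogeneous continuous function calculus for $X$. For $e\in X^+$, let $I_e=\{x\in X: |x|\le\lambda e\text{ for some }\lambda\in[0,\infty)\}$ be the order ideal generated by $e$, and let $\|x\|_e=\inf\{\lambda\in[0,\infty): |x|\le\lambda e\}$ for $x\in I_e$; this is a lattice norm on $I_e$ when $X$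 is Archimedean. An Archimedean vector lattice $X$ is finitely uniformly complete if, for each $n\in\mathbb{N}$ and $x_1,\ldots,x_n\in X$, there is a positive element $e\in X$ such that $e\ge|x_1|\vee\cdots\vee|x_n|$ and the norm $\|\cdot\|_e$ is complete on the closed sublattice of $(I_e,\|\cdot\|_e)$ generated by $x_1,\ldots,x_n$ (the smallest closed sublattice containing these elements). *)

(* Defs.v *)
From HB Require Import structures.
From mathcomp Require Import all_boot all_order all_algebra.
From mathcomp Require Import boolp classical_sets functions reals.
From mathcomp Require Import topology normedtype.

Set Implicit Arguments.
Unset Strict Implicit.
Unset Printing Implicit Defensive.

Import Order.TTheory GRing.Theory Num.Theory.
Import numFieldNormedType.Exports.

Local Open Scope classical_set_scope.
Local Open Scope ring_scope.

(* Requiring Order.Lattice here would create a missing join with the numeric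
   structures of ring_display, hence the lattice operations are fields, with the
   axioms of Order.POrder_MeetJoin_isLattice. *)
HB.mixin Record POrderedLmodule_isVectorLattice (R : numDomainType) X
    of GRing.Lmodule R X & Order.POrder ring_display X := {
  vlerD2r : forall z x y : X, x <= y -> x + z <= y + z;
  vscaler_ge0 : forall (a : R) (x : X), 0 <= a -> 0 <= x -> 0 <= a *: x;
  vjoin : X -> X -> X;
  vmeet : X -> X -> X;
  vleUx : forall x y z : X, (vjoin x y <= z) = (x <= z) && (y <= z);
  vlexI : forall x y z : X, (x <= vmeet y z) = (x <= y) && (x <= z)
}.

#[short(type="vectorLatticeType")]
HB.structure Definition VectorLattice (R : numDomainType) :=
  { X of GRing.Lmodule R X & Order.POrder ring_display X
       & POrderedLmodule_isVectorLattice R X }.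

Definition vabs (R : numDomainType) (X : vectorLatticeType R) (x : X) : X :=
  vjoin x (- x).

Definition archimedean (R : numDomainType) (X : vectorLatticeType R) : Prop :=
  forall x y : X, 0 <= x -> 0 <= y ->
    (forall n : nat, (0 < n)%N -> x *+ n <= y) -> x = 0.

Definition vlattice_hom (R : numDomainType) (X Y : vectorLatticeType R)
    (phi : X -> Y) : Prop :=
  [/\ linear phi,
      {morph phi : x y / vjoin x y >-> vjoin x y} &
      {morph phi : x y / vmeet x y >-> vmeet x y}].

Definition sublattice (R : numDomainType) (X : vectorLatticeType R)
    (S : set X) : Prop :=
  [/\ S 0,
      forall (a : R) x y, S x -> S y -> S (a *: x + y),
      forall x y, S x -> S y -> S (vjoin x y) &
      forall x y, S x -> S y -> S (vmeet x y)].

Section PositivelyHomogeneous.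
Context {R : realType}.

Definition positively_homogeneous n (f : 'rV[R]_n -> R) : Prop :=
  forall (l : R) (t : 'rV[R]_n), 0 <= l -> f (l *: t) = l * f t.

Definition phc_pred n : {pred 'rV[R]_n -> R} :=
  mem [set f | positively_homogeneous f /\ continuous f].

Lemma phc_submod_closed n : submod_closed (@phc_pred n).
Proof.
split=> [|a f g].
  apply/mem_set; split=> [l t _|]; last exact: cst_continuous.
  by rewrite -[RHS]/(l * 0) mulr0.
move=> /set_mem[fh fc] /set_mem[gh gc]; apply/mem_set; split=> [l t l0|t].
  rewrite -[LHS]/(a *: f (l *: t) + g (l *: t)) fh// gh//.
  by rewrite -[RHS]/(l * (a *: f t + g t)) mulrDr scalerAr.
have lin (T : topologicalType) (u v : T -> R) x : {for x, continuous u} ->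
    {for x, continuous v} -> {for x, continuous (fun y => a * u y + v y)}.
  by move=> uc vc; apply: cvgD => //; apply: cvgMl_tmp.
exact: lin (fc t) (gc t).
Qed.

HB.instance Definition _ n :=
  GRing.isSubmodClosed.Build _ _ (@phc_pred n) (@phc_submod_closed n).

Record phcfun (n : nat) := Phcfun {
  phcfun_val :> 'rV[R]_n -> R;
  phcfunP : phcfun_val \in @phc_pred n
}.

HB.instance Definition _ n := [isSub for @phcfun_val n].
HB.instance Definition _ n := [Choice of phcfun n by <:].
HB.instance Definition _ n := [SubChoice_isSubLmodule of phcfun n by <:].
HB.instance Definition _ n :=
  [SubChoice_isSubPOrder of phcfun n by <: with ring_display].

Lemma phcfun_lerD2r n (h f g : phcfun n) : f <= g -> f + h <= g + h.
Proof.
rewrite -!Order.le_val => /lefP fg; apply/lefP => t.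
by rewrite -[leLHS]/(f t + h t) -[leRHS]/(g t + h t) lerD2r; exact: fg.
Qed.

Lemma phcfun_scaler_ge0 n (a : R) (f : phcfun n) :
  0 <= a -> 0 <= f -> 0 <= a *: f.
Proof.
move=> a0; rewrite -!Order.le_val => /lefP f0; apply/lefP => t.
by apply: mulr_ge0 => //; exact: f0.
Qed.

Lemma phcmax_subproof n (f g : phcfun n) :
  (fun t => Num.max (f t) (g t)) \in @phc_pred n.
Proof.
have [[fh fc] [gh gc]] := (set_mem (phcfunP f), set_mem (phcfunP g)).
apply/mem_set; split=> [l t l0|t]; first by rewrite fh// gh// maxr_pMr.
by apply: continuous_max; [exact: fc|exact: gc].
Qed.

Lemma phcmin_subproof n (f g : phcfun n) :
  (fun t => Num.min (f t) (g t)) \in @phc_pred n.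
Proof.
have [[fh fc] [gh gc]] := (set_mem (phcfunP f), set_mem (phcfunP g)).
apply/mem_set; split=> [l t l0|t]; first by rewrite fh// gh// minr_pMr.
by apply: continuous_min; [exact: fc|exact: gc].
Qed.

Definition phcmax n (f g : phcfun n) : phcfun n := Phcfun (phcmax_subproof f g).
Definition phcmin n (f g : phcfun n) : phcfun n := Phcfun (phcmin_subproof f g).

Lemma phcfun_leUx n (f g h : phcfun n) :
  (phcmax f g <= h) = (f <= h) && (g <= h).
Proof.
rewrite -!Order.le_val; apply/idP/andP => [/lefP fgh|[/lefP fh /lefP gh]].
  by split; apply/lefP => t; move: (fgh t); rewrite ge_max => /andP[].
by apply/lefP => t; rewrite ge_max fh gh.
Qed.

Lemma phcfun_lexI n (f g h : phcfun n) :
  (f <= phcmin g h) = (f <= g) && (f <= h).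
Proof.
rewrite -!Order.le_val; apply/idP/andP => [/lefP fgh|[/lefP fh /lefP gh]].
  by split; apply/lefP => t; move: (fgh t); rewrite le_min => /andP[].
by apply/lefP => t; rewrite le_min fh gh.
Qed.

HB.instance Definition _ n := POrderedLmodule_isVectorLattice.Build R (phcfun n)
  (@phcfun_lerD2r n) (@phcfun_scaler_ge0 n) (@phcfun_leUx n) (@phcfun_lexI n).

Lemma phcproj_subproof n (i : 'I_n) :
  (fun t : 'rV[R]_n => t ord0 i) \in @phc_pred n.
Proof.
by apply/mem_set; split=> [l t _|]; [rewrite mxE|exact: coord_continuous].
Qed.

Definition phcproj n (i : 'I_n) : phcfun n := Phcfun (phcproj_subproof i).

Lemma phccomp_subproof m n (g : phcfun m) (f : 'I_m -> phcfun n) :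
  (fun t : 'rV[R]_n => g (\row_j f j t)) \in @phc_pred n.
Proof.
have [gh gc] := set_mem (phcfunP g).
have fP j := set_mem (phcfunP (f j)).
apply/mem_set; split=> [l t l0|t].
  rewrite -gh//; congr (g _); apply/rowP => j; rewrite !mxE.
  by have [-> ] := fP j.
apply: (@continuous_comp _ _ _ (fun t => \row_j f j t) g); last exact: gc.
have rowc (T : topologicalType) (F : 'I_m -> T -> R) (x : T) :
    (forall j, {for x, continuous (F j)}) ->
    {for x, continuous (fun y => \row_j F j y)}.
  move=> Fc A [P nP PA].
  have : \forall y \near x, forall j, P ord0 j (F j y).
    by apply: filter_forall => j; apply: Fc; move: (nP ord0 j); rewrite mxE.
  by apply: filterS => y Py; apply: PA => i j; rewrite mxE (ord1 i).
by apply: rowc => j; have [_ fc] := fP j; exact: fc.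
Qed.

Definition phccomp m n (g : phcfun m) (f : 'I_m -> phcfun n) : phcfun n :=
  Phcfun (phccomp_subproof g f).

End PositivelyHomogeneous.
Arguments phcfun R n : clear implicits.

Section FunctionCalculus.
Context {R : realType} {X : vectorLatticeType R}.

Definition calculus_at n (x : 'I_n -> X) (phi : phcfun R n -> X) : Prop :=
  vlattice_hom phi /\ forall i, phi (phcproj i) = x i.

(* The value of a calculus at the index n = 0 is irrelevant. *)
Definition is_calculus (Phi : forall n, ('I_n -> X) -> phcfun R n -> X) : Prop :=
  forall n (x : 'I_n -> X), (0 < n)%N -> calculus_at x (Phi n x).

End FunctionCalculus.

Definition admits_calculus (R : realType) (X : vectorLatticeType R) : Prop :=
  forall n (x : 'I_n -> X), (0 < n)%N -> exists phi, calculus_at x phi.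

Section OrderUnitNorm.
Context {R : realType} {X : vectorLatticeType R}.

Definition order_ideal (e : X) : set X :=
  [set x | exists2 l : R, 0 <= l & vabs x <= l *: e].

Definition order_norm (e x : X) : R :=
  inf [set l : R | 0 <= l /\ vabs x <= l *: e].

(* S is norm closed in the order ideal of e, not just in X. *)
Definition closed_sublattice (e : X) (S : set X) : Prop :=
  [/\ S `<=` order_ideal e, sublattice S &
      forall x, order_ideal e x ->
        (forall eps : R, 0 < eps -> exists2 y, S y & order_norm e (x - y) < eps) ->
        S x].

Definition norm_complete (e : X) (S : set X) : Prop :=
  forall u : nat -> X, (forall k, S (u k)) ->
    (forall eps : R, 0 < eps ->
       \forall p & q \near \oo, order_norm e (u p - u q) < eps) ->
    exists2 y, S y & order_norm e (u k - y) @[k --> \oo] --> (0 : R).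

End OrderUnitNorm.

(* The join starts at 0, which is neutral since absolute values are positive. *)
Definition finitely_uniformly_complete (R : realType) (X : vectorLatticeType R) :
    Prop :=
  forall n (x : 'I_n -> X), (0 < n)%N -> exists e : X,
    [/\ 0 <= e, \big[vjoin/0]_(i < n) vabs (x i) <= e &
        norm_complete e (smallest (closed_sublattice e) (range x))].

(* Main.v *)
Require Import Defs.
From mathcomp Require Import all_boot all_order all_algebra.
From mathcomp Require Import boolp classical_sets reals.
From mathcomp Require Import topology normedtype interval_inference finmap.
From mathcomp Require Import ring lra.

Set Implicit Arguments.
Unset Strict Implicit.
Unset Printing Implicit Defensive.

Import Order.TTheory GRing.Theory Num.Theory.
Import numFieldNormedType.Exports.

Local Open Scope classical_set_scope.
Local Open Scope ring_scope.

(** The theorem rests on two facts about the space [phcfun R n] of homogeneous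
    functions. First, a sublattice containing the projections is dense for the
    norm of the order unit [phcl1 = |t_1| + ... + |t_n|] ([sublattice_dense], a
    lattice form of the Stone-Weierstrass theorem on the unit sphere). Secondly,
    the space is complete for that norm ([phcfun_complete]).

    Uniqueness is immediate from density, since two homomorphisms agree on a
    sublattice and the Archimedean property forbids infinitesimal differences
    ([calculus_unique]). The composition rule is a case of uniqueness: both sides
    are homomorphisms in [g] with the same values at the projections.

    If a calculus [phi] exists at [x], take [e = |x_1| + ... + |x_n|], which is
    [phi phcl1]. Truncation lets one lift a small vector of the range of [phi] to
    a small function, so a Cauchy sequence in the range lifts to a convergent
    sequence of functions, and the range is complete
    ([calculus_range_complete]). The closed sublattice generated by [x] sits in
    the range as a closed subset, and inherits completeness.

    For the converse, let [e] dominate the [|x_i|]. A functional representation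
    of the ideal of [e] is avoided by saying directly, inside [X], what it means
    for a vector [y] to be [f(x_1, ..., x_n)]: for each [eps] there is a [K] with
    [|y - f(t) e| <= eps e + K * (|x_1 - t_1 e| + ... + |x_n - t_n e|)] for all
    [t] in the unit box ([represents]). This relation is compatible with the
    operations and with limits. It determines [y], because the sums on the right
    have no strictly positive lower bound as [t] varies
    ([le_sum_dist_scale_le0]): this is where an elementary lattice argument
    replaces the points of a representation space. The functions represented by a
    vector of a complete sublattice form a sublattice containing the projections,
    so density and completeness show that every function is represented
    ([represents_exists]), and the resulting map is the calculus. *)

(** * Vector lattices *)

Section VectorLatticeTheory.
Context {R : realType} {X : vectorLatticeType R}.
Implicit Types (x y z w : X) (a b : R).

Lemma vlerD x y z w : x <= y -> z <= w -> x + z <= y + w.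
Proof.
move=> xy zw; apply: (@le_trans _ _ (y + z)); first exact: vlerD2r.
by rewrite ![y + _]addrC; exact: vlerD2r.
Qed.

Lemma vlerBlDr x y z : (x - y <= z) = (x <= z + y).
Proof.
by apply/idP/idP => [/(vlerD2r y)|/(vlerD2r (- y))]; rewrite ?subrK ?addrK.
Qed.

Lemma vlerBrDr x y z : (x <= y - z) = (x + z <= y).
Proof.
by apply/idP/idP => [/(vlerD2r z)|/(vlerD2r (- z))]; rewrite ?subrK ?addrK.
Qed.

Lemma vsubr_ge0 x y : (0 <= y - x) = (x <= y).
Proof. by rewrite vlerBrDr add0r. Qed.

Lemma vlerN2 x y : (- x <= - y) = (y <= x).
Proof. by rewrite -[LHS]vsubr_ge0 opprK addrC vsubr_ge0. Qed.

Lemma vlerNl x y : (- x <= y) = (- y <= x).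
Proof. by rewrite -vlerN2 opprK. Qed.

Lemma vaddr_ge0 x y : 0 <= x -> 0 <= y -> 0 <= x + y.
Proof. by move=> x0 y0; rewrite -[0]addr0; exact: vlerD. Qed.

Lemma vlerZ a x y : 0 <= a -> x <= y -> a *: x <= a *: y.
Proof.
by move=> a0 xy; rewrite -vsubr_ge0 -scalerBr vscaler_ge0// vsubr_ge0.
Qed.

Lemma vlerZl a b x : 0 <= x -> a <= b -> a *: x <= b *: x.
Proof.
by move=> x0 ab; rewrite -vsubr_ge0 -scalerBl vscaler_ge0// subr_ge0.
Qed.

Lemma vle_half x y : x + x <= y -> x <= (2^-1 : R) *: y.
Proof.
have half : 2^-1 + 2^-1 = 1 :> R by lra.
move=> xy; rewrite (_ : x = (2^-1 : R) *: (x + x)); last first.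
  by rewrite scalerDr -scalerDl half scale1r.
by apply: vlerZ xy; rewrite invr_ge0.
Qed.

Lemma vsumr_ge0 (I : finType) (F : I -> X) :
  (forall i, 0 <= F i) -> 0 <= \sum_i F i.
Proof. by move=> F0; elim/big_ind: _ => //; exact: vaddr_ge0. Qed.

Lemma vjoinl x y : x <= vjoin x y.
Proof. by have := lexx (vjoin x y); rewrite vleUx => /andP[]. Qed.

Lemma vjoinr x y : y <= vjoin x y.
Proof. by have := lexx (vjoin x y); rewrite vleUx => /andP[]. Qed.

Lemma vmeetl x y : vmeet x y <= x.
Proof. by have := lexx (vmeet x y); rewrite vlexI => /andP[]. Qed.

Lemma vmeetr x y : vmeet x y <= y.
Proof. by have := lexx (vmeet x y); rewrite vlexI => /andP[]. Qed.

Lemma vjoin_le x y z : x <= z -> y <= z -> vjoin x y <= z.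
Proof. by rewrite vleUx => -> ->. Qed.

Lemma vle_meet x y z : x <= y -> x <= z -> x <= vmeet y z.
Proof. by rewrite vlexI => -> ->. Qed.

Lemma vmeetE x y : vmeet x y = - vjoin (- x) (- y).
Proof.
apply/eqP; rewrite eq_le; apply/andP; split.
  by rewrite -vlerN2 opprK vjoin_le// vlerN2 ?vmeetl ?vmeetr.
by apply: vle_meet; rewrite vlerNl ?vjoinl ?vjoinr.
Qed.

Lemma vjoinr_id x y : x <= y -> vjoin x y = y.
Proof. by move=> xy; apply/eqP; rewrite eq_le vjoinr vjoin_le. Qed.

Lemma vjoinZ a x y : 0 <= a -> a *: vjoin x y = vjoin (a *: x) (a *: y).
Proof.
rewrite le_eqVlt => /predU1P[<-|a0].
  by rewrite !scale0r vjoinr_id.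
apply/eqP; rewrite eq_le; apply/andP; split; last first.
  by rewrite vjoin_le// vlerZ ?vjoinl ?vjoinr// ltW.
rewrite -[leRHS](@scalerKV _ _ a) ?gt_eqF//.
by apply: vlerZ; [exact: ltW|apply: vjoin_le];
  rewrite -[leLHS](@scalerK _ _ a) ?gt_eqF// vlerZ ?vjoinl ?vjoinr//
    invr_ge0 ltW.
Qed.

(** A case distinction along [w <= vjoin x y]: the distributive law of
    [vmeet] over [vjoin], in the form that lets one argue as if the order were
    total. *)
Lemma vle_join_cases x y w z :
  w <= vjoin x y -> vmeet x w <= z -> vmeet y w <= z -> w <= z.
Proof.
move=> wxy xz yz; set p := vjoin (vjoin x y - w) 0.
(* Cutting the excess [p] of [vjoin x y] over [w] off a smaller [u] leaves
     something below both [u] and [w]. *)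
have below u : u <= vjoin x y -> u - p <= vmeet u w.
  move=> uxy; apply: vle_meet; rewrite vlerBlDr.
    by rewrite -[leLHS]addr0 vlerD// vjoinr.
  by apply: le_trans uxy _; rewrite addrC -vlerBlDr vjoinl.
have pE : p = vjoin x y - w.
  by rewrite -[RHS](vjoinr_id (x := 0)) ?vsubr_ge0//; apply/eqP;
    rewrite eq_le !vjoin_le ?vjoinl ?vjoinr.
have -> : w = vjoin x y - p by rewrite pE opprB addrC subrK.
rewrite vlerBlDr; apply: vjoin_le; rewrite -vlerBlDr.
- exact: le_trans (below x (vjoinl _ _)) xz.
- exact: le_trans (below y (vjoinr _ _)) yz.
Qed.

Lemma vabs_le x y : (vabs x <= y) = (x <= y) && (- x <= y).
Proof. exact: vleUx. Qed.

Lemma ler_vabs x : x <= vabs x.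
Proof. exact: vjoinl. Qed.

Lemma lerN_vabs x : - x <= vabs x.
Proof. exact: vjoinr. Qed.

Lemma vabs_ge0 x : 0 <= vabs x.
Proof.
rewrite -vlerN2 oppr0 -(scaler0 _ (2^-1 : R)); apply: vle_half.
rewrite -[leRHS](subrr x); apply: vlerD; first by rewrite vlerNl lerN_vabs.
by rewrite vlerN2 ler_vabs.
Qed.

Lemma vabsN x : vabs (- x) = vabs x.
Proof.
have le y : vabs (- y) <= vabs y.
  by rewrite vabs_le opprK lerN_vabs ler_vabs.
by apply/eqP; rewrite eq_le le/= -{1}[x]opprK le.
Qed.

Lemma vabs0 : vabs 0 = 0 :> X.
Proof. by apply/eqP; rewrite eq_le vabs_ge0 vabs_le oppr0 lexx. Qed.

Lemma vabsB x y : vabs (x - y) = vabs (y - x).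
Proof. by rewrite -vabsN opprB. Qed.

Lemma vabsD x y : vabs (x + y) <= vabs x + vabs y.
Proof.
by rewrite vabs_le opprD; apply/andP; split; rewrite vlerD ?ler_vabs
  ?lerN_vabs.
Qed.

Lemma vabs_dist x y z : vabs (x - z) <= vabs (x - y) + vabs (y - z).
Proof. by have := vabsD (x - y) (y - z); rewrite addrA subrK. Qed.

Lemma vabsZ a x : vabs (a *: x) = `|a| *: vabs x.
Proof.
have pos b : 0 <= b -> vabs (b *: x) = b *: vabs x.
  by move=> b0; rewrite /vabs vjoinZ// scalerN.
case: (leP 0 a) => a0; first by rewrite pos// ger0_norm.
by rewrite ltr0_norm// -pos ?oppr_ge0 ?ltW// scaleNr vabsN.
Qed.

Lemma vjoin_dist x y z w :
  vabs (vjoin x y - vjoin z w) <= vabs (x - z) + vabs (y - w).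
Proof.
have half x' y' z' w' :
    vjoin x' y' - vjoin z' w' <= vabs (x' - z') + vabs (y' - w').
  rewrite vlerBlDr; apply: vjoin_le.
    rewrite -[x'](subrK z') vlerD ?vjoinl// -[leLHS]addr0.
    by rewrite vlerD ?subrK ?ler_vabs ?vabs_ge0.
  rewrite -[y'](subrK w') vlerD ?vjoinr// -[leLHS]add0r.
  by rewrite vlerD ?subrK ?ler_vabs ?vabs_ge0.
by rewrite vabs_le half/= opprB [vabs (x - _)]vabsB [vabs (y - _)]vabsB half.
Qed.

Lemma vabs_le0 x : vabs x <= 0 -> x = 0.
Proof.
rewrite vabs_le => /andP[x0 Nx0]; apply/eqP; rewrite eq_le x0 /=.
by rewrite -vlerN2 oppr0.
Qed.

Lemma vle_sum1 (I : finType) (F : I -> X) i :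
  (forall j, 0 <= F j) -> F i <= \sum_j F j.
Proof.
move=> F0; rewrite (bigD1 i)//= -[leLHS]addr0 vlerD//.
by elim/big_ind: _ => // *; exact: vaddr_ge0.
Qed.

Lemma vbigjoin_ge (I : finType) (F : I -> X) i :
  F i <= \big[vjoin/0]_j F j.
Proof.
elim: (index_enum I) (mem_index_enum i) => // j s IH.
rewrite inE big_cons => /predU1P[<-|/IH h]; first exact: vjoinl.
by apply: le_trans h _; exact: vjoinr.
Qed.

Lemma vbigjoin_le (I : finType) (F : I -> X) z :
  0 <= z -> (forall i, F i <= z) -> \big[vjoin/0]_j F j <= z.
Proof. by move=> z0 Fz; elim/big_ind: _ => // x y; exact: vjoin_le. Qed.

Lemma sublattice_join (S : set X) :
  S 0 -> (forall a x y, S x -> S y -> S (a *: x + y)) ->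
  (forall x y, S x -> S y -> S (vjoin x y)) -> sublattice S.
Proof.
move=> S0 SD SJ; split => // x y Sx Sy.
have SN z : S z -> S (- z).
  by move=> /(SD (-1) _ _)/(_ S0); rewrite scaleN1r addr0.
by rewrite vmeetE; apply/SN/SJ; exact: SN.
Qed.

Lemma sublatticeZ (S : set X) a x : sublattice S -> S x -> S (a *: x).
Proof. by case=> S0 SD _ _ Sx; rewrite -[_ *: _]addr0; exact: SD. Qed.

Lemma sublatticeD (S : set X) x y : sublattice S -> S x -> S y -> S (x + y).
Proof. by case=> _ SD _ _ Sx Sy; rewrite -[x]scale1r; exact: SD. Qed.

Lemma sublatticeB (S : set X) x y : sublattice S -> S x -> S y -> S (x - y).
Proof. by case=> _ SD _ _ Sx Sy; rewrite addrC -scaleN1r; exact: SD. Qed.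

Lemma sublattice_abs (S : set X) x : sublattice S -> S x -> S (vabs x).
Proof.
move=> SS; case: (SS) => _ _ SJ _ Sx; apply: SJ => //.
by rewrite -scaleN1r; exact: sublatticeZ.
Qed.

Lemma sublattice_sum (S : set X) (I : finType) (F : I -> X) :
  sublattice S -> (forall i, S (F i)) -> S (\sum_i F i).
Proof.
move=> SS SF; elim/big_ind: _ => //; first by case: SS.
by move=> x y; exact: sublatticeD.
Qed.

Lemma archimedean_le0 x e : archimedean X -> 0 <= e ->
  (forall eps : R, 0 < eps -> x <= eps *: e) -> x <= 0.
Proof.
move=> arch e0 xe; have x0 : vjoin x 0 = 0.
  apply: (arch _ e) => // [|k k0]; first exact: vjoinr.
  have kR : 0 < k%:R :> R by rewrite ltr0n.
  rewrite -scaler_nat -[leRHS](@scalerKV _ _ k%:R) ?gt_eqF//.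
  apply: vlerZ; first exact: ltW.
  by apply: vjoin_le; [apply: xe|apply: vscaler_ge0 => //];
    rewrite ?ltW// invr_gt0.
by rewrite -x0; exact: vjoinl.
Qed.

Lemma archimedean_le x y e : archimedean X -> 0 <= e ->
  (forall eps : R, 0 < eps -> x <= y + eps *: e) -> x <= y.
Proof.
move=> arch e0 h; rewrite -[y]add0r -vlerBlDr; apply: archimedean_le0 e0 _ => //.
by move=> eps /h; rewrite vlerBlDr addrC.
Qed.

Lemma archimedean_eq x y e : archimedean X -> 0 <= e ->
  (forall eps : R, 0 < eps -> vabs (x - y) <= eps *: e) -> x = y.
Proof.
move=> arch e0 h; apply/subr0_eq/vabs_le0.
exact: archimedean_le0 e0 h.
Qed.

End VectorLatticeTheory.

Section Homomorphisms.
Context {R : realType} {X Y : vectorLatticeType R}.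

Lemma vlattice_hom_join (phi : X -> Y) : linear phi ->
  {morph phi : x y / vjoin x y >-> vjoin x y} -> vlattice_hom phi.
Proof.
move=> lin join; split => // x y.
have phiN z : phi (- z) = - phi z.
  have p0 : phi 0 = 0.
    by have := lin 1 0 0; rewrite !scale1r addr0 -{1}[phi 0]addr0 => /addrI.
  by have := lin (-1) z 0; rewrite !scaleN1r p0 !addr0.
by rewrite !vmeetE phiN join !phiN.
Qed.

Variables (phi : X -> Y) (hom : vlattice_hom phi).

Lemma hom0 : phi 0 = 0.
Proof.
case: hom => lin _ _.
by have := lin 1 0 0; rewrite !scale1r addr0 -{1}[phi 0]addr0 => /addrI.
Qed.

Lemma homZ a x : phi (a *: x) = a *: phi x.
Proof. by case: hom => lin _ _; have := lin a x 0; rewrite hom0 !addr0. Qed.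

Lemma homD x y : phi (x + y) = phi x + phi y.
Proof. by case: hom => lin _ _; have := lin 1 x y; rewrite !scale1r. Qed.

Lemma homB x y : phi (x - y) = phi x - phi y.
Proof. by rewrite homD -scaleN1r homZ scaleN1r. Qed.

Lemma hom_le x y : x <= y -> phi x <= phi y.
Proof.
case: hom => _ join _ xy.
by rewrite -(vjoinr_id xy) join; exact: vjoinl.
Qed.

Lemma hom_abs x : phi (vabs x) = vabs (phi x).
Proof. by case: hom => _ join _; rewrite /vabs join -scaleN1r homZ scaleN1r. Qed.

Lemma hom_sum (I : finType) (F : I -> X) : phi (\sum_i F i) = \sum_i phi (F i).
Proof. by apply: (big_morph phi homD hom0). Qed.

End Homomorphisms.

(** * Positively homogeneous continuous functions *)

Section PHCTheory.
Context {R : realType} {n : nat}.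
Implicit Types (f g h : phcfun R n) (s t : 'rV[R]_n) (S : set (phcfun R n)).

Lemma phcfun_ext f g : (forall t, f t = g t) -> f = g.
Proof. by move=> fg; apply/val_inj/funext. Qed.

Lemma phcfun_leP f g : reflect (forall t, f t <= g t) (f <= g).
Proof. by rewrite -Order.le_val; exact: lefP. Qed.

Lemma phcfunZDE (a : R) f g t : (a *: f + g) t = a * f t + g t.
Proof. by []. Qed.

Lemma phcfunDE f g t : (f + g) t = f t + g t.
Proof. by []. Qed.

Lemma phcfunBE f g t : (f - g) t = f t - g t.
Proof. by []. Qed.

Lemma phcfunZE (a : R) f t : (a *: f) t = a * f t.
Proof. by []. Qed.

Lemma phcfun_joinE f g t : (vjoin f g : phcfun R n) t = Num.max (f t) (g t).
Proof. by []. Qed.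

Lemma phcfun_absE f t : (vabs f : phcfun R n) t = `|f t|.
Proof.
rewrite phcfun_joinE -[(- f) t]/(- f t).
case: (lerP 0 (f t)) => ft.
  by rewrite max_l ?ger0_norm// (le_trans _ ft)// oppr_le0.
by rewrite max_r ?ltr0_norm// (le_trans (ltW ft))// oppr_ge0 ltW.
Qed.

Lemma phcfun_sumE (I : finType) (F : I -> phcfun R n) t :
  (\sum_i F i) t = \sum_i F i t.
Proof. by apply: (big_morph (fun f : phcfun R n => f t)). Qed.

Lemma phcfun_homogeneous f (l : R) t : 0 <= l -> f (l *: t) = l * f t.
Proof. by case: (set_mem (phcfunP f)) => h _; exact: h. Qed.

Lemma phcfun_continuous f : continuous f.
Proof. by case: (set_mem (phcfunP f)). Qed.

Lemma phcfun0 f : f 0 = 0.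
Proof. by rewrite -(scale0r (0 : 'rV[R]_n)) phcfun_homogeneous ?mul0r. Qed.

(** The norm [t |-> |t_1| + ... + |t_n|]: it lies in every sublattice
    containing the projections, and is an order unit. *)
Definition phcl1 : phcfun R n := \sum_i vabs (phcproj i).

Lemma phcl1E t : phcl1 t = \sum_i `|t ord0 i|.
Proof. by rewrite phcfun_sumE; apply: eq_bigr => i _; rewrite phcfun_absE. Qed.

Lemma phcl1_ge0 t : 0 <= phcl1 t.
Proof. by rewrite phcl1E sumr_ge0. Qed.

Lemma phcl1_coord t i : `|t ord0 i| <= phcl1 t.
Proof. by rewrite phcl1E (bigD1 i)//= lerDl sumr_ge0. Qed.

Lemma phcl1_eq0 t : phcl1 t = 0 -> t = 0.
Proof.
move=> t0; apply/rowP => i; rewrite mxE; apply/eqP.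
by rewrite -normr_le0 -t0 phcl1_coord.
Qed.

Lemma phcfun_le_sphere f g :
  (forall t, phcl1 t = 1 -> f t <= g t) -> f <= g.
Proof.
move=> fg; apply/phcfun_leP => t.
have [t0|t0] := eqVneq (phcl1 t) 0; first by rewrite (phcl1_eq0 t0) !phcfun0.
have p0 : 0 < phcl1 t by rewrite lt0r t0 phcl1_ge0.
have : f ((phcl1 t)^-1 *: t) <= g ((phcl1 t)^-1 *: t).
  by apply: fg; rewrite phcfun_homogeneous ?invr_ge0 ?phcl1_ge0// mulVf.
by rewrite !phcfun_homogeneous ?invr_ge0 ?phcl1_ge0// ler_pM2l ?invr_gt0.
Qed.

Lemma compact_sphere : compact [set t | phcl1 t = 1].
Proof.
apply: subclosed_compact (rV_compact (fun _ => @segment_compact R (-1) 1)) _.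
  rewrite (_ : [set t | _] = phcl1 @^-1` [set 1]) //.
  apply: preimage_closed; first by move=> t _; exact: phcfun_continuous.
  exact: closed_eq.
by move=> t /= t1 i /=; rewrite in_itv/= -ler_norml -t1 phcl1_coord.
Qed.

Lemma phcfun_bounded f : exists2 C : R, 0 <= C & vabs f <= C *: phcl1.
Proof.
have /compact_bounded[M [_ /(_ (`|M| + 1))]] :
    compact (f @` [set t | phcl1 t = 1]).
  apply: continuous_compact compact_sphere.
  exact/continuous_subspaceT/phcfun_continuous.
rewrite (le_lt_trans (ler_norm M)) ?ltrDl// => /(_ isT) fM.
exists (`|M| + 1); first by rewrite addr_ge0.
apply: phcfun_le_sphere => t t1; rewrite phcfun_absE phcfunZE t1 mulr1.
by apply: fM; exists t.
Qed.

Lemma phcl1_sublattice S : sublattice S -> (forall i, S (phcproj i)) -> S phcl1.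
Proof.
by move=> SS Sp; apply: sublattice_sum => // i; exact: sublattice_abs.
Qed.

(** At a point [s] of the unit sphere, [f s + eps + M * dist(t, s)] with a steep
    slope [M] lies above [f]. On the sphere [phcl1] equals [1], so that it can
    stand for the constant function and for the scale of [s]: this turns the
    formula into a lattice-linear expression in the projections. *)
Lemma local_majorant S f s (eps : R) :
  sublattice S -> (forall i, S (phcproj i)) -> 0 < eps -> phcl1 s = 1 ->
  exists g, [/\ S g, f <= g & g s < f s + 2 * eps].
Proof.
move=> SS Sp eps0 s1.
have [C C0 fC] := phcfun_bounded f.
have [d /= d0 dP] : exists2 d : R, 0 < d &
    forall t, (forall i, `|s ord0 i - t ord0 i| < d) -> f t < f s + eps.
  have : nbhs s (f @^-1` [set r | r < f s + eps]).
    by apply: (@phcfun_continuous f s); apply: lt_nbhsl; rewrite ltrDl.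
  move=> /nbhs_ballP[d /= d0 dP]; exists d => // t td; apply: dP.
  by split=> // i j; rewrite ord1; exact: td.
(* At distance [d] or more, the slope makes up for the oscillation [2 * C]. *)
pose M := 2 * C / d; have M0 : 0 <= M.
  by apply: divr_ge0; [exact: mulr_ge0|exact: ltW].
pose D : phcfun R n := \sum_i vabs (phcproj i - s ord0 i *: phcl1).
have DE t : phcl1 t = 1 -> D t = \sum_i `|t ord0 i - s ord0 i|.
  move=> t1; rewrite phcfun_sumE; apply: eq_bigr => i _.
  by rewrite phcfun_absE phcfunBE phcfunZE t1 mulr1.
exists ((f s + eps) *: phcl1 + M *: D); split.
- have Sl := phcl1_sublattice SS Sp.
  apply: sublatticeD => //; apply: sublatticeZ => //.
  apply: sublattice_sum => // i; apply: sublattice_abs => //.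
  by apply: sublatticeB => //; exact: sublatticeZ.
- apply: phcfun_le_sphere => t t1.
  rewrite phcfunDE !phcfunZE t1 mulr1 DE//.
  have D0 : 0 <= \sum_i `|t ord0 i - s ord0 i| by rewrite sumr_ge0.
  have [near|far] := ltP (\sum_i `|t ord0 i - s ord0 i|) d.
    apply/ltW/ltr_wpDr; [exact: mulr_ge0|apply: dP => i].
    rewrite distrC; apply: le_lt_trans near.
    by rewrite (bigD1 i)//= lerDl sumr_ge0.
  have bound u : phcl1 u = 1 -> `|f u| <= C.
    move=> u1; move/phcfun_leP: fC => /(_ u).
    by rewrite phcfun_absE phcfunZE u1 mulr1.
  have MD : 2 * C <= M * \sum_i `|t ord0 i - s ord0 i|.
    rewrite (le_trans (y := M * d))//; last by rewrite ler_wpM2l.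
    by rewrite /M divfK ?gt_eqF.
  move: (bound t t1) (bound s s1); rewrite !ler_norml => /andP[_ ft] /andP[fs _].
  lra.
- rewrite phcfunDE !phcfunZE s1 mulr1 DE// big1 ?mulr0 => [|i _]; last first.
    by rewrite subrr normr0.
  lra.
Qed.

(** The lattice form of the Stone-Weierstrass theorem, for homogeneous
    functions: by compactness of the unit sphere, the minimum of finitely many
    local majorants is within [eps] of [f] there, and homogeneity does the
    rest. *)
Lemma sublattice_dense S f (eps : R) :
  sublattice S -> (forall i, S (phcproj i)) -> 0 < eps ->
  exists2 g, S g & vabs (f - g) <= eps *: phcl1.
Proof.
move=> SS Sp eps0; have eps2 : 0 < eps / 2 by rewrite divr_gt0.
have [g gP] : exists g : 'rV[R]_n -> phcfun R n, forall s, phcl1 s = 1 ->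
    [/\ S (g s), f <= g s & (g s) s < f s + eps].
  have ex s : exists gs, phcl1 s = 1 -> [/\ S gs, f <= gs & gs s < f s + eps].
    have [s1|s1] := eqVneq (phcl1 s) 1; last first.
      by exists f => /eqP; rewrite (negPf s1).
    have [h [Sh fh hs]] := local_majorant f SS Sp eps2 s1.
    exists h => _; split => //.
    by rewrite (_ : eps = 2 * (eps / 2)); last by field.
  by have [g gP] := choice ex; exists g.
have := @compact_sphere; rewrite compact_cover.
move=> /(_ _ [set t | phcl1 t = 1] (fun s => [set t | (g s - f) t < eps])).
case.
- move=> s _; rewrite (_ : [set t | _] = (g s - f) @^-1` [set r | r < eps])//.
  by apply: open_comp => // t _; exact: phcfun_continuous.
- move=> s s1; exists s => //=; have [_ _ gs] := gP s s1.
  by rewrite -[ltLHS]/(g s s - f s) ltrBlDl.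
move=> D DK cov.
have [C C0 fC] := phcfun_bounded f.
(* The minimum starts at the majorant [C *: phcl1], which handles [l] empty. *)
have finite_min (l : seq 'rV[R]_n) : (forall s, s \in l -> phcl1 s = 1) ->
    exists h, [/\ S h, f <= h & forall s, s \in l -> h <= g s].
  elim: l => [_|s l IH sl].
    exists (C *: phcl1); split => //.
      by apply: sublatticeZ => //; exact: phcl1_sublattice.
    by apply: le_trans fC; exact: ler_vabs.
  have [|h [Sh fh hl]] := IH.
    by move=> u ul; apply: sl; rewrite inE ul orbT.
  have [Ss fs _] := gP s (sl s (mem_head _ _)).
  exists (vmeet h (g s)); split; first by case: SS => _ _ _; exact.
    exact: vle_meet.
  move=> u; rewrite inE => /predU1P[->|/hl hu]; first exact: vmeetr.
  by apply: le_trans hu; exact: vmeetl.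
have [h [Sh fh hD]] :
    exists h, [/\ S h, f <= h & forall s, s \in D -> h <= g s].
  by apply: (finite_min (D : seq _)) => s /DK/set_mem.
exists h; first exact: Sh.
apply: phcfun_le_sphere => t t1.
rewrite phcfun_absE phcfunBE phcfunZE t1 mulr1.
have [s /= sD st] := cov t t1.
move/phcfun_leP: fh => /(_ t) fht; move/phcfun_leP: (hD s sD) => /(_ t) hgt.
rewrite ler0_norm ?subr_le0// opprB ltW//.
by apply: le_lt_trans st; rewrite -[leRHS]/(g s t - f t) lerD2r.
Qed.

End PHCTheory.

Section PHCCompleteness.
Context {R : realType} {n : nat}.
Local Notation phcl1 := (@phcl1 R n).

(** Homogeneity and continuity survive in the limit because the error bound
    [eps * phcl1] is itself homogeneous and locally bounded. *)
Lemma phc_pred_limit (G : 'rV[R]_n -> R) :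
  (forall eps : R, 0 < eps ->
     exists f : phcfun R n, forall t, `|G t - f t| <= eps * phcl1 t) ->
  G \in @phc_pred R n.
Proof.
move=> appr; apply/mem_set; split => [l t l0|t].
  apply/subr0_eq/eqP; rewrite -normr_le0; apply/ler_addgt0Pl => e e0.
  rewrite addr0.
  pose B := 2 * l * phcl1 t + 1.
  have B0 : 0 < B by rewrite ltr_wpDl// !mulr_ge0 ?phcl1_ge0.
  have [f fG] := appr (e / B) (divr_gt0 e0 B0).
  have := fG (l *: t); have := fG t.
  rewrite !phcfun_homogeneous// => Gt Glt.
  have -> : G (l *: t) - l * G t = (G (l *: t) - l * f t) - l * (G t - f t).
    by ring.
  rewrite (le_trans (ler_normB _ _))// normrM (ger0_norm l0).
  rewrite (le_trans (lerD Glt (ler_wpM2l l0 Gt)))//.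
  have -> : e / B * (l * phcl1 t) + l * (e / B * phcl1 t) =
    e * ((2 * l * phcl1 t) / B) by field; rewrite gt_eqF.
  by rewrite ler_piMr ?(ltW e0)// ler_pdivrMr// mul1r lerDl.
apply/(@cvgrPdist_lt _ _ _ (nbhs t) (nbhs_filter t)) => e e0.
pose B := phcl1 t + 1.
have B0 : 0 < B by rewrite ltr_wpDl// phcl1_ge0.
have [f fG] := appr (e / (3 * B)) (divr_gt0 e0 (mulr_gt0 (ltr0n _ 3) B0)).
have small u : phcl1 u < B -> `|G u - f u| <= e / 3.
  move=> uB; rewrite (le_trans (fG u))// (le_trans (y := e / (3 * B) * B))//.
    by rewrite ler_wpM2l ?ltW// ?divr_gt0// mulr_gt0.
  by rewrite invfM mulrA mulfVK// gt_eqF.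
have tB : phcl1 t < B by rewrite ltrDl.
have e3 : 0 < e / 3 by rewrite divr_gt0.
have nB : nbhs t (phcl1 @^-1` [set r | r < B]).
  by apply: (@phcfun_continuous R n phcl1 t); exact: lt_nbhsl.
have /(@cvgrPdist_lt _ _ _ (nbhs t) (nbhs_filter t))/(_ _ e3) nf :=
  @phcfun_continuous R n f t.
near=> u.
have uB : phcl1 u < B by near: u; exact: nB.
have fu : `|f t - f u| < e / 3 by near: u; exact: nf.
move: (small t tB) (small u uB) fu.
rewrite !ler_norml !ltr_norml => /andP[? ?] /andP[? ?] /andP[? ?].
by apply/andP; split; lra.
Unshelve. all: by end_near. Qed.

(** A sequence with geometrically small steps converges: its limit is the
    supremum of the increasing sequence [F k - 2 ^ (1 - k) * phcl1], whose
    distance to the decreasing sequence [F k + 2 ^ (1 - k) * phcl1] vanishes. *)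
Lemma phcfun_complete (F : nat -> phcfun R n) :
  (forall k, vabs (F k.+1 - F k) <= (2^-1 ^+ k) *: phcl1) ->
  exists G, forall k, vabs (G - F k) <= (2 * 2^-1 ^+ k) *: phcl1.
Proof.
move=> step; pose c k : R := 2^-1 ^+ k.
have cS k : c k = 2 * c k.+1 by rewrite /c exprS; field.
pose lo k t := F k t - 2 * c k * phcl1 t.
pose up k t := F k t + 2 * c k * phcl1 t.
have stepE k t : `|F k.+1 t - F k t| <= c k * phcl1 t.
  by move/phcfun_leP: (step k) => /(_ t); rewrite phcfun_absE.
have lo_le k l t : (k <= l)%N -> lo k t <= lo l t.
  apply: (homo_leq (f := lo^~ t) (r := <=%R)) => // [u v w|i].
    exact: le_trans.
  have := stepE i t; rewrite ler_norml => /andP[h _].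
  by rewrite /lo (cS i) in h *; lra.
have up_ge k l t : (k <= l)%N -> up l t <= up k t.
  apply: (homo_leq (f := up^~ t) (r := fun x y => y <= x)) => // [u v w uv vw|i].
    exact: le_trans vw uv.
  have := stepE i t; rewrite ler_norml => /andP[_ h].
  by rewrite /up (cS i) in h *; lra.
have lo_up k l t : lo k t <= up l t.
  apply: le_trans (lo_le _ _ t (leq_maxl k l)) _.
  apply: le_trans (up_ge _ _ t (leq_maxr k l)).
  rewrite /lo /up; have : 0 <= c (maxn k l) * phcl1 t.
    by rewrite mulr_ge0 ?phcl1_ge0// exprn_ge0// invr_ge0.
  by lra.
pose G t := sup (range (lo^~ t)).
have GP k t : `|G t - F k t| <= 2 * c k * phcl1 t.
  rewrite ler_distl; apply/andP; split.
    apply: ub_le_sup; last by exists k.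
    by exists (up k t) => _ [l _ <-].
  apply: ge_sup; first by exists (lo k t), k.
  by move=> _ [l _ <-]; exact: lo_up.
have Gphc : G \in @phc_pred R n.
  apply: phc_pred_limit => eps eps0.
  have eps2 : 0 < eps / 2 by rewrite divr_gt0.
  have [k _ /(_ k (leqnn k)) ck] := near_infty_natSinv_expn_lt (PosNum eps2).
  exists (F k) => t; apply: le_trans (GP k t) _.
  rewrite ler_wpM2r ?phcl1_ge0// mulrC -ler_pdivlMr// ltW// (le_lt_trans _ ck)//.
  by rewrite /c exprVn div1r.
exists (Phcfun Gphc) => k; apply/phcfun_leP => t.
by rewrite phcfun_absE; exact: GP.
Qed.

End PHCCompleteness.

(** * The order unit norm *)

Section OrderUnitNormTheory.
Context {R : realType} {X : vectorLatticeType R}.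
Variable e : X.
Hypothesis e0 : 0 <= e.
Implicit Types (x y : X) (S : set X).

Lemma order_idealB x y :
  order_ideal e x -> order_ideal e y -> order_ideal e (x - y).
Proof.
move=> [a a0 xa] [b b0 yb]; exists (a + b); first exact: addr_ge0.
apply: le_trans (vabsD _ _) _.
by rewrite vabsN scalerDl; exact: vlerD.
Qed.

Lemma order_norm_le x (c : R) : 0 <= c -> vabs x <= c *: e -> order_norm e x <= c.
Proof.
move=> c0 xc; apply: ge_inf; last by [].
by exists 0 => z [].
Qed.

Lemma order_norm_lt x (c : R) :
  order_ideal e x -> order_norm e x < c -> vabs x <= c *: e.
Proof.
rewrite /order_norm; set E := [set l : R | _] => -[a a0 xa] xc.
have hE : has_inf E by split; [exists a|exists 0 => z []].
have c0 : 0 < c - inf E by rewrite subr_gt0.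
have [l [_ xl]] := inf_adherent c0 hE; rewrite addrC subrK => /ltW lc.
exact: le_trans xl (vlerZl e0 lc).
Qed.

Lemma order_norm_ge0 x : 0 <= order_norm e x.
Proof.
rewrite /order_norm; set E := [set l : R | _].
have [[l El]|E0] := pselect (E !=set0).
  by apply: lb_le_inf; [exists l|move=> z []].
by rewrite inf_out// => -[].
Qed.

(** Infimum-free form of [norm_complete], equivalent to it for subsets of the
    order ideal ([norm_completeE]). *)
Definition order_unit_complete S : Prop :=
  forall u : nat -> X, (forall k, S (u k)) ->
    (forall eps : R, 0 < eps -> exists N, forall p q, (N <= p)%N -> (N <= q)%N ->
       vabs (u p - u q) <= eps *: e) ->
    exists2 y, S y & forall eps : R, 0 < eps ->
      exists N, forall k, (N <= k)%N -> vabs (u k - y) <= eps *: e.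

Lemma norm_completeE S : S `<=` order_ideal e ->
  norm_complete e S <-> order_unit_complete S.
Proof.
move=> SI; split => cpl u uS uC.
- have [eps eps0|y Sy uy] := cpl u uS.
    have [|N NP] := uC (eps / 2); first by rewrite divr_gt0.
    exists ([set k | (N <= k)%N], [set k | (N <= k)%N]); first by split; exists N.
    move=> [p q] /= [Np Nq].
    apply: le_lt_trans (order_norm_le _ (NP p q Np Nq)) _.
      by rewrite divr_ge0 ?ltW.
    by rewrite gtr_pMr// invf_lt1 ?ltr1n.
  exists y => // eps eps0.
  have /cvgr0Pnorm_lt/(_ eps eps0)[N _ NP] := uy.
  exists N => k Nk; apply: order_norm_lt; first by apply: order_idealB; exact: SI.
  exact: le_lt_trans (ler_norm _) (NP k Nk).
- have [eps eps0|y Sy uy] := cpl u uS.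
    have [[A B] /= [[N _ NA] [M _ MB]] AB] := uC eps eps0.
    exists (maxn N M) => p q; rewrite !geq_max => /andP[Np _] /andP[_ Mq].
    apply: order_norm_lt; first by apply: order_idealB; exact: SI.
    by apply: (AB (p, q)); split; [exact: NA|exact: MB].
  exists y => //; apply/cvgr0Pnorm_le => eps eps0.
  have [N NP] := uy eps eps0; exists N => // k /NP uk.
  by rewrite ger0_norm ?order_norm_ge0// order_norm_le// ltW.
Qed.

(** A complete sublattice is closed: in an Archimedean space, an element that is
    approximated by [S] is the limit in [S] of its approximants. *)
Lemma order_unit_complete_closed S : archimedean X -> S `<=` order_ideal e ->
  sublattice S -> order_unit_complete S -> closed_sublattice e S.
Proof.
move=> arch SI SS cpl; split => // x xI appr.
have ex k : exists y, S y /\ vabs (x - y) <= k.+1%:R^-1 *: e.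
  have [|y Sy xy] := appr k.+1%:R^-1; first by rewrite invr_gt0.
  by exists y; split => //; apply: order_norm_lt => //; apply/order_idealB/SI.
have [u uP] := choice ex.
have small (eps : R) : 0 < eps ->
    exists N, forall k, (N <= k)%N -> vabs (x - u k) <= eps *: e.
  move=> eps0; have [N _ NP] := near_infty_natSinv_lt (PosNum eps0).
  exists N => k Nk; have [_ /le_trans] := uP k; apply.
  by apply: vlerZl => //; apply/ltW/NP.
have dist y z w (eps : R) : vabs (y - z) <= (eps / 2) *: e ->
    vabs (z - w) <= (eps / 2) *: e -> vabs (y - w) <= eps *: e.
  move=> yz zw; apply: le_trans (vabs_dist _ z _) _.
  by rewrite (splitr eps) scalerDl; exact: vlerD.
have [k|eps eps0|y Sy uy] := cpl u; first by have [] := uP k.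
  have [|N NP] := small (eps / 2); first by rewrite divr_gt0.
  exists N => p q /NP xp /NP xq; apply: dist xq; by rewrite vabsB.
rewrite (_ : x = y)//; apply: archimedean_eq arch e0 _ => eps eps0.
have eps2 : 0 < eps / 2 by rewrite divr_gt0.
have [[N NP] [M MP]] := (small _ eps2, uy _ eps2).
by apply: dist (NP _ (leq_maxl N M)) (MP _ (leq_maxr N M)).
Qed.

End OrderUnitNormTheory.

(** * Representing a function by a vector *)

Section Grid.
Context {R : realType} {X : vectorLatticeType R}.
Variables (e : X) (archX : archimedean X) (e0 : 0 <= e).

(** No strictly positive vector lies below all distances from [x] to multiples of
    [e], because [x] cannot avoid a fine grid of them.
    Along the grid [s_0 = -1 < ... < s_(N+1) = 1] of step [d], induction on [j]
    shows that [v] lies below the join of [d *: e] and [x - s_j *: e]; the latter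
    is nonpositive when [s_j = 1]. The crucial case of the step is
    [x - s_j *: e >= v] and [x - s_(j+1) *: e <= - v]: as these vectors are
    [d *: e] apart, [v] is at most half of that. *)
Lemma le_dist_scale_le0 (x v : X) : vabs x <= e ->
  (forall s : R, `|s| <= 1 -> v <= vabs (x - s *: e)) -> v <= 0.
Proof.
move=> xe vP; apply: archimedean_le0 archX e0 _ => eps eps0.
have eps2 : 0 < eps / 2 by rewrite divr_gt0.
have [N _ /(_ N (leqnn N)) /= Neps] := near_infty_natSinv_lt (PosNum eps2).
pose d : R := 2 / N.+1%:R; pose s j : R := j%:R * d - 1.
have N0 : 0 < N.+1%:R :> R by rewrite ltr0n.
have d0 : 0 <= d by rewrite divr_ge0 ?ltW.
have sS j : s j.+1 = s j + d by rewrite /s -natr1; ring.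
have sN : s N.+1 = 1 by rewrite /s /d; field; rewrite gt_eqF.
have grid j : (j <= N.+1)%N -> v <= vjoin (d *: e) (x - s j *: e).
  elim: j => [_|j IH jN].
    have v0 : v <= vabs (x - s 0%N *: e).
      by apply: vP; rewrite /s mul0r sub0r normrN1.
    apply: le_trans v0 _; have s0 : s 0%N = -1 by rewrite /s mul0r sub0r.
    have xe0 : 0 <= x - s 0%N *: e.
      rewrite s0 scaleN1r opprK addrC -[x]opprK vsubr_ge0.
      by rewrite (le_trans (lerN_vabs x)).
    apply: vjoin_le; first exact: vjoinr.
    apply: le_trans (vjoinr _ _); rewrite (le_trans _ xe0)//.
    by rewrite -oppr0 vlerN2.
  apply: vle_join_cases (IH (ltnW jN)) _ _.
    exact: le_trans (vmeetl _ _) (vjoinl _ _).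
  set w := vmeet _ v.
  have wj : w <= vabs (x - s j.+1 *: e).
    apply: le_trans (vmeetr _ _) (vP _ _); rewrite ler_norml; apply/andP; split.
      by rewrite /s lerBrDr addNr mulr_ge0.
    rewrite -sN /s lerD2r ler_wpM2r// ler_nat //.
  apply: vle_join_cases wj _ _; first exact: le_trans (vmeetl _ _) (vjoinr _ _).
  set w' := vmeet _ w; apply: le_trans (vjoinl _ _).
  have : w' + w' <= d *: e.
    have -> : d *: e = - (x - s j.+1 *: e) + (x - s j *: e).
      by rewrite sS scalerDl opprB addrA subrK addrAC subrr add0r.
    apply: vlerD; first exact: vmeetl.
    exact: le_trans (vmeetr _ _) (vmeetl _ _).
  move=> /vle_half/le_trans; apply; rewrite scalerA.
  by apply: vlerZl => //; rewrite ler_piMl// invf_le1 ?ler1n.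
apply: le_trans (grid N.+1 (leqnn _)) _; apply: vjoin_le.
  apply: vlerZl => //; rewrite /d mulrC -ler_pdivlMr//; exact: ltW.
rewrite sN scale1r; apply: (@le_trans _ _ 0).
  by rewrite vlerBlDr add0r (le_trans (ler_vabs x)).
by apply: vscaler_ge0 => //; exact: ltW.
Qed.

(** One coordinate at a time: what remains after moving the other distances to
    the left lies below all distances from [x ord0] to multiples of [e]. *)
Lemma le_sum_dist_scale_le0 n (x : 'I_n -> X) (v : X) :
  (forall i, vabs (x i) <= e) ->
  (forall t : 'I_n -> R, (forall i, `|t i| <= 1) ->
    v <= \sum_i vabs (x i - t i *: e)) -> v <= 0.
Proof.
elim: n x v => [|n IH] x v xe vP.
  by have := vP (fun=> 0) (fun=> ltac:(by rewrite normr0)); rewrite big_ord0.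
apply: (IH (fun i => x (lift ord0 i))) => // t t1.
rewrite -[leRHS]add0r -vlerBlDr.
apply: (le_dist_scale_le0 (xe ord0)) => s s1; rewrite vlerBlDr.
pose t' i := if unlift ord0 i is Some j then t j else s.
have /vP : forall i, `|t' i| <= 1 by move=> i; rewrite /t'; case: unliftP.
rewrite big_ord_recl /t' unlift_none; congr (_ <= _ + _).
by apply: eq_bigr => i _; rewrite liftK.
Qed.

End Grid.

Section Representation.
Context {R : realType} {X : vectorLatticeType R}.
Variables (e : X) (archX : archimedean X) (e0 : 0 <= e).
Variables (n : nat) (x : 'I_n -> X) (xe : forall i, vabs (x i) <= e).
Implicit Types (f g : phcfun R n) (y z : X) (t : 'rV[R]_n).

Let dist t : X := \sum_i vabs (x i - t ord0 i *: e).

Let box t : Prop := forall i, `|t ord0 i| <= 1.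

(** The vector [y] has the right to be called [f(x_1, ..., x_n)] when it satisfies
    the estimate [|f(x) - f(t)| <= eps + K * |x - t|_1], in which [e] stands for
    the constant function [1]. When [X] is a space of functions and [e = 1], this
    expresses the uniform continuity of [f]; yet it makes sense in any vector
    lattice. *)
Definition represents f y : Prop := forall eps : R, 0 < eps ->
  exists2 K : R, 0 <= K &
    forall t, box t -> vabs (y - f t *: e) <= eps *: e + K *: dist t.

Let dist_ge0 t : 0 <= dist t.
Proof. by apply: vsumr_ge0 => i; exact: vabs_ge0. Qed.

Lemma represents_proj i : represents (phcproj i) (x i).
Proof.
move=> eps eps0; exists 1 => // t _; rewrite scale1r -[leLHS]add0r vlerD//.
  by rewrite vscaler_ge0// ltW.
apply: (vle_sum1 (F := fun j => vabs (x j - t ord0 j *: e))) => j.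
exact: vabs_ge0.
Qed.

Lemma represents_lin (a : R) f g y z :
  represents f y -> represents g z -> represents (a *: f + g) (a *: y + z).
Proof.
move=> fy gz eps eps0; pose b := `|a| + 1.
have b0 : 0 < b by rewrite ltr_wpDl.
have [|K K0 KP] := fy (eps / 2 / b); first by rewrite !divr_gt0.
have [|L L0 LP] := gz (eps / 2); first by rewrite divr_gt0.
exists (b * K + L) => [|t tb]; first by rewrite addr_ge0// mulr_ge0// ltW.
have -> : a *: y + z - (a *: f + g) t *: e =
    a *: (y - f t *: e) + (z - g t *: e).
  by rewrite phcfunZDE scalerDl scalerBr scalerA opprD addrACA.
apply: le_trans (vabsD _ _) _.
apply: (@le_trans _ _ (b *: vabs (y - f t *: e) + vabs (z - g t *: e))).
  by apply: vlerD => //; rewrite vabsZ; apply: vlerZl; rewrite ?vabs_ge0// lerDl.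
apply: le_trans (vlerD (vlerZ (ltW b0) (KP t tb)) (LP t tb)) _.
rewrite scalerDr !scalerA addrACA -!scalerDl.
by rewrite mulrC divfK ?gt_eqF// -splitr.
Qed.

Lemma represents_join f g y z :
  represents f y -> represents g z -> represents (vjoin f g) (vjoin y z).
Proof.
move=> fy gz eps eps0.
have eps2 : 0 < eps / 2 by rewrite divr_gt0.
have [[K K0 KP] [L L0 LP]] := (fy _ eps2, gz _ eps2).
exists (K + L) => [|t tb]; first by rewrite addr_ge0.
have -> : (vjoin f g : phcfun R n) t *: e = vjoin (f t *: e) (g t *: e).
  have joinC u w : vjoin u w = vjoin w u :> X.
    by apply/eqP; rewrite eq_le !vjoin_le ?vjoinl ?vjoinr.
  rewrite phcfun_joinE; case: (leP (f t) (g t)) => fg.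
    by rewrite vjoinr_id// vlerZl.
  by rewrite joinC vjoinr_id// vlerZl// ltW.
apply: le_trans (vjoin_dist _ _ _ _) _.
apply: le_trans (vlerD (KP t tb) (LP t tb)) _.
by rewrite addrACA -(scalerDl e) -(scalerDl (dist t)) -splitr.
Qed.

Lemma represents_limit f y :
  (forall eps : R, 0 < eps -> exists g z, [/\ represents g z,
     forall t, box t -> `|f t - g t| <= eps & vabs (y - z) <= eps *: e]) ->
  represents f y.
Proof.
move=> appr eps eps0; have eps3 : 0 < eps / 3 by rewrite divr_gt0.
have [g [z [gz fg yz]]] := appr _ eps3; have [K K0 KP] := gz _ eps3.
exists K => // t tb.
apply: le_trans (vabs_dist _ z _) _.
have fgt : vabs (g t *: e - f t *: e) <= (eps / 3) *: e.
  rewrite -scalerBl vabsZ (_ : vabs e = e); last first.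
    apply/eqP; rewrite eq_le ler_vabs andbT vabs_le lexx/=.
    by rewrite (le_trans _ e0)// -oppr0 vlerN2.
  by apply: vlerZl => //; rewrite distrC fg.
apply: le_trans (vlerD yz (le_trans (vabs_dist _ (g t *: e) _)
  (vlerD (KP t tb) fgt))) _.
rewrite [_ *: e + K *: _ + _]addrAC addrA -!(scalerDl e).
by rewrite (_ : eps / 3 + (eps / 3 + eps / 3) = eps)//; field.
Qed.

(** The order of functions on the box carries over to the vectors representing
    them: letting [t] vary, [K * dist t] comes close to [0]. *)
Lemma represents_le f y (c : R) :
  represents f y -> (forall t, box t -> f t <= c) -> y <= c *: e.
Proof.
move=> fy fc; apply: archimedean_le archX e0 _ => eps eps0.
have [K K0 KP] := fy _ eps0.
have K1 : 0 < K + 1 by rewrite ltr_wpDl.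
have : (K + 1)^-1 *: (y - (c *: e + eps *: e)) <= 0.
  apply: (le_sum_dist_scale_le0 archX e0 xe) => t t1.
  have tb : box (\row_i t i) by move=> i; rewrite mxE.
  rewrite -[leRHS](@scalerK _ _ (K + 1)) ?gt_eqF//.
  apply: vlerZ; first by rewrite invr_ge0 ltW.
  have -> : \sum_i vabs (x i - t i *: e) = dist (\row_i t i).
    by apply: eq_bigr => i _; rewrite mxE.
  apply: (@le_trans _ _ (K *: dist (\row_i t i))); last first.
    by apply: vlerZl => //; rewrite lerDl.
  rewrite vlerBlDr [leRHS]addrC -addrA.
  have -> : y = f (\row_i t i) *: e + (y - f (\row_i t i) *: e).
    by rewrite addrC subrK.
  apply: vlerD; first by apply: vlerZl => //; exact: fc.
  exact: le_trans (ler_vabs _) (KP _ tb).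
move=> /(vlerZ (ltW K1)); rewrite scalerKV ?gt_eqF// scaler0.
by rewrite vlerBlDr add0r.
Qed.

Lemma represents_dist f g y z (c : R) : represents f y -> represents g z ->
  (forall t, box t -> `|f t - g t| <= c) -> vabs (y - z) <= c *: e.
Proof.
move=> fy gz fg; rewrite vabs_le opprB.
by apply/andP; split; rewrite addrC -scaleN1r;
  [apply: (represents_le (represents_lin (-1) gz fy))
  |apply: (represents_le (represents_lin (-1) fy gz))] => t tb;
  rewrite phcfunZDE mulN1r addrC; have := fg t tb; rewrite ler_norml => /andP[];
  lra.
Qed.

Lemma represents_inj f y z : represents f y -> represents f z -> y = z.
Proof.
move=> fy fz; apply/subr0_eq/vabs_le0; rewrite -(scale0r e).
by apply: represents_dist fy fz _ => t _; rewrite subrr normr0.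
Qed.

(** Functions represented in [S] form a sublattice, so [f] is a limit of such
    functions; their representing vectors are Cauchy, and converge to one for
    [f]. *)
Lemma represents_exists (S : set X) f : sublattice S -> (forall i, S (x i)) ->
  order_unit_complete e S -> exists2 y, S y & represents f y.
Proof.
move=> SS Sx cpl.
pose A := [set g : phcfun R n | exists2 z, S z & represents g z].
have AS : sublattice A.
  case: (SS) => S0 SD SJ _; apply: sublattice_join.
  - exists 0 => // eps eps0; exists 0 => // t _.
    have -> : (0 : phcfun R n) t *: e = 0 by exact: scale0r.
    by rewrite subrr vabs0 scale0r addr0 vscaler_ge0// ltW.
  - move=> a g h [y Sy gy] [z Sz hz].
    by exists (a *: y + z); [exact: SD|exact: represents_lin].
  - move=> g h [y Sy gy] [z Sz hz].
    by exists (vjoin y z); [exact: SJ|exact: represents_join].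
have Ap i : A (phcproj i) by exists (x i) => //; exact: represents_proj.
have l1_box t : box t -> phcl1 t <= n%:R.
  move=> tb; rewrite phcl1E (le_trans (ler_sum _ (fun i _ => tb i)))//.
  by rewrite sumr_const card_ord.
have ex k : exists gz : phcfun R n * X, [/\ S gz.2, represents gz.1 gz.2 &
    forall t, box t -> `|f t - gz.1 t| <= k.+1%:R^-1].
  (* On the box [phcl1] is at most [n]. *)
  have eps0 : 0 < k.+1%:R^-1 / n.+1%:R :> R by rewrite divr_gt0// invr_gt0.
  have [g [z Sz gz] fg] := sublattice_dense f AS Ap eps0.
  exists (g, z); split => // t tb; move/phcfun_leP: fg => /(_ t).
  rewrite phcfun_absE => /le_trans; apply; rewrite phcfunZE -mulrA ler_piMr//.
  rewrite mulrC ler_pdivrMr// mul1r (le_trans (l1_box t tb))//.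
  by rewrite ler_nat.
have [gz gzP] := choice ex.
have small (eps : R) : 0 < eps ->
    exists N, forall k, (N <= k)%N -> k.+1%:R^-1 <= eps.
  move=> eps0; have [N _ NP] := near_infty_natSinv_lt (PosNum eps0).
  by exists N => k Nk; apply/ltW/NP.
have [k|eps eps0|y Sy yP] := cpl (fun k => (gz k).2); first by have [] := gzP k.
  have [|N NP] := small (eps / 2); first by rewrite divr_gt0.
  exists N => p q Np Nq; have [_ gp fp] := gzP p; have [_ gq fq] := gzP q.
  apply: represents_dist gp gq _ => t tb; rewrite (splitr eps).
  apply: le_trans (ler_distD (f t) _ _) _; apply: lerD.
    by rewrite distrC (le_trans (fp t tb))// NP.
  by rewrite (le_trans (fq t tb))// NP.
exists y => //; apply: represents_limit => eps eps0.
have [[N NP] [M MP]] := (small _ eps0, yP _ eps0).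
have [_ gP fg] := gzP (maxn N M).
exists (gz (maxn N M)).1, (gz (maxn N M)).2; split => //.
  by move=> t tb; rewrite (le_trans (fg t tb))// NP// leq_maxl.
by rewrite vabsB MP// leq_maxr.
Qed.

Lemma represents_calculus (S : set X) : sublattice S -> (forall i, S (x i)) ->
  order_unit_complete e S -> exists phi : phcfun R n -> X, calculus_at x phi.
Proof.
move=> SS Sx cpl.
have [phi phiP] : exists phi : phcfun R n -> X, forall f, represents f (phi f).
  have ex f : exists y, represents f y.
    by have [y _ yP] := represents_exists f SS Sx cpl; exists y.
  by have [phi phiP] := choice ex; exists phi.
exists phi; split => [|i]; last first.
  exact: represents_inj (phiP _) (represents_proj i).
apply: vlattice_hom_join => [a f g|f g]; apply: represents_inj (phiP _) _.
  exact: represents_lin.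
exact: represents_join.
Qed.

End Representation.

(** * Uniqueness of the calculus and completeness of its range *)

Section Calculus.
Context {R : realType} {X : vectorLatticeType R}.
Hypothesis archX : archimedean X.

Lemma hom_phcl1 n (x : 'I_n -> X) phi : calculus_at x phi ->
  phi (phcl1 : phcfun R n) = \sum_i vabs (x i).
Proof.
move=> [hom proj]; rewrite (hom_sum hom); apply: eq_bigr => i _.
by rewrite (hom_abs hom) proj.
Qed.

(** The functions on which two homomorphisms agree form a sublattice, which is
    dense once it contains the projections. *)
Lemma calculus_unique n (x : 'I_n -> X) phi psi :
  calculus_at x phi -> calculus_at x psi -> phi = psi.
Proof.
move=> cphi cpsi; have [hphi pphi] := cphi; have [hpsi ppsi] := cpsi.
pose S := [set f : phcfun R n | phi f = psi f].
have SS : sublattice S.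
  apply: sublattice_join => [|a f g fS gS|f g fS gS]; rewrite /S/=.
  - by rewrite (hom0 hphi) (hom0 hpsi).
  - by rewrite (homD hphi) (homD hpsi) (homZ hphi) (homZ hpsi) fS gS.
  - by case: hphi hpsi => [_ -> _] [_ -> _]; rewrite fS gS.
have Sp i : S (phcproj i) by rewrite /S/= pphi ppsi.
pose e := \sum_i vabs (x i).
have e0 : 0 <= e by apply: vsumr_ge0 => i; exact: vabs_ge0.
apply/funext => f; apply: archimedean_eq archX e0 _ => eps eps0.
have [|g gS fg] := sublattice_dense f SS Sp (_ : 0 < eps / 2).
  by rewrite divr_gt0.
have near chi : calculus_at x chi -> vabs (chi f - chi g) <= (eps / 2) *: e.
  move=> cchi; have [hchi _] := cchi.
  rewrite /e -(hom_phcl1 cchi) -(homZ hchi) -(homB hchi) -(hom_abs hchi).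
  exact: hom_le.
apply: le_trans (vabs_dist _ (phi g) _) _.
rewrite (splitr eps) scalerDl; apply: vlerD; first exact: near.
by rewrite [phi g]gS vabsB near.
Qed.

Lemma calculus_comp m n (x : 'I_n -> X) phi (f : 'I_m -> phcfun R n) :
  calculus_at x phi ->
  calculus_at (fun j => phi (f j)) (fun g => phi (phccomp g f)).
Proof.
move=> [[lin join _] _].
split; first apply: vlattice_hom_join => [a g h|g h].
- by rewrite -lin; congr phi; exact: phcfun_ext.
- by rewrite -join; congr phi; exact: phcfun_ext.
by move=> j; congr phi; apply: phcfun_ext => t; rewrite /= mxE.
Qed.

(** Truncation at [p] turns any preimage of a small vector into a small
    preimage. *)
Lemma hom_lift (Y : vectorLatticeType R) (phi : Y -> X) d p :
  vlattice_hom phi -> 0 <= p -> vabs (phi d) <= phi p ->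
  exists2 d', phi d' = phi d & vabs d' <= p.
Proof.
move=> hom p0; rewrite vabs_le => /andP[dp Ndp].
have phiN z : phi (- z) = - phi z by rewrite -[- z]add0r homB// hom0// add0r.
have Npp : - p <= p by rewrite (le_trans _ p0)// -oppr0 vlerN2.
exists (vjoin (vmeet d p) (- p)).
  case: (hom) => _ -> ->; rewrite phiN.
  have -> : vmeet (phi d) (phi p) = phi d.
    by apply/eqP; rewrite eq_le vmeetl vle_meet.
  apply/eqP; rewrite eq_le vjoinl andbT vjoin_le//.
  by rewrite vlerNl.
by rewrite vabs_le vjoin_le ?vmeetr//= vlerNl vjoinr.
Qed.

(** A Cauchy sequence in the range of a calculus is lifted, after passing to a
    subsequence with geometrically small steps, to a convergent sequence of
    functions; the steps are lifted one at a time. *)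
Lemma calculus_range_complete n (x : 'I_n -> X) phi :
  calculus_at x phi -> order_unit_complete (\sum_i vabs (x i)) (range phi).
Proof.
move=> cphi; have [hom _] := cphi; rewrite -(hom_phcl1 cphi).
set p : phcfun R n := phcl1 => u uS uC.
have p0 : 0 <= p by apply: vsumr_ge0 => i; exact: vabs_ge0.
have pp0 : 0 <= phi p by rewrite -(hom0 hom); exact: hom_le.
pose c k : R := 2^-1 ^+ k.
have c0 k : 0 < c k by rewrite exprn_gt0// invr_gt0.
have [N NP] := choice (fun k => uC _ (c0 k)).
pose m k := (\sum_(j < k.+1) N j)%N.
have Nm k j : (j <= k)%N -> (N j <= m k)%N.
  by rewrite -ltnS => jk; rewrite /m (bigD1 (Ordinal jk))//= leq_addr.
have [h hP] : exists h : nat -> phcfun R n, forall k, phi (h k) = u (m k).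
  have ex k : exists h, phi h = u (m k) by have [f _ fu] := uS (m k); exists f.
  by have [h hP] := choice ex; exists h.
have ex_lift (kd : nat * phcfun R n) : exists d',
    vabs (phi kd.2) <= c kd.1 *: phi p ->
    phi d' = phi kd.2 /\ vabs d' <= c kd.1 *: p.
  case: kd => k d /=.
  have [dp|] := pselect (vabs (phi d) <= c k *: phi p); last by exists d.
  have [||d' d'd d'p] := hom_lift (d := d) (p := c k *: p) hom.
  - by rewrite vscaler_ge0// ltW.
  - by rewrite (homZ hom).
  - by exists d' => _.
have [lift liftP] := choice ex_lift.
pose F := fix F k := if k is j.+1 then F j + lift (j, h j.+1 - F j) else h 0%N.
have [FP step] : (forall k, phi (F k) = u (m k)) /\
    (forall k, vabs (F k.+1 - F k) <= c k *: p).
  have main k : phi (F k) = u (m k) ->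
      phi (F k.+1) = u (m k.+1) /\ vabs (F k.+1 - F k) <= c k *: p.
    move=> Fk; have [|Lk Lp] := liftP (k, h k.+1 - F k).
      by rewrite (homB hom) hP Fk; apply: NP; exact: Nm.
    split; last by rewrite /= addrC addKr.
    by rewrite /= (homD hom) Lk/= (homB hom) hP addrC subrK.
  have FP k : phi (F k) = u (m k) by elim: k => [|k /main[]//]; exact: hP.
  by split => // k; have [] := main k (FP k).
have [G GP] := phcfun_complete step.
exists (phi G); first by exists G.
move=> eps eps0; have eps3 : 0 < eps / 3 by rewrite divr_gt0.
have [j _ /(_ j (leqnn j)) /= cj] := near_infty_natSinv_expn_lt (PosNum eps3).
have {}cj : c j < eps / 3 by rewrite /c exprVn -div1r.
exists (m j) => k jk.
have ukj : vabs (u k - u (m j)) <= c j *: phi p.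
  by apply: NP; [exact: leq_trans (Nm _ _ (leqnn j)) jk|exact: Nm].
have FG : vabs (u (m j) - phi G) <= (2 * c j) *: phi p.
  rewrite -FP vabsB -(homB hom) -(hom_abs hom) -(homZ hom).
  by apply: hom_le => //; exact: GP.
apply: le_trans (vabs_dist _ (u (m j)) _) (le_trans (vlerD ukj FG) _).
by rewrite -scalerDl; apply: vlerZl => //; lra.
Qed.

Lemma calculus_range_closed n (x : 'I_n -> X) phi : calculus_at x phi ->
  closed_sublattice (\sum_i vabs (x i)) (range phi).
Proof.
move=> cphi; have [hom proj] := cphi.
apply: order_unit_complete_closed => //.
- by apply: vsumr_ge0 => i; exact: vabs_ge0.
- move=> _ [f _ <-]; have [C C0 fC] := phcfun_bounded f; exists C => //.
  rewrite -(hom_phcl1 cphi) -(hom_abs hom) -(homZ hom); exact: hom_le.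
- case: (hom) => lin join _; apply: sublattice_join.
  + by exists 0 => //; exact: hom0.
  + by move=> a _ _ [f _ <-] [g _ <-]; exists (a *: f + g) => //; exact: lin.
  + by move=> _ _ [f _ <-] [g _ <-]; exists (vjoin f g) => //; exact: join.
- exact: calculus_range_complete.
Qed.

End Calculus.

(** * Calculus and finite uniform completeness *)

Section Equivalence.
Context {R : realType} {X : vectorLatticeType R}.
Hypothesis archX : archimedean X.

(** The closed sublattice generated by the [x i] is contained in the range of the
    calculus; being closed in a complete space, it is complete. *)
Lemma calculus_finitely_uniformly_complete :
  admits_calculus X -> finitely_uniformly_complete X.
Proof.
move=> cal n x n0; have [phi cphi] := cal n x n0; have [hom proj] := cphi.
pose e := \sum_i vabs (x i).
have e0 : 0 <= e by apply: vsumr_ge0 => i; exact: vabs_ge0.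
have ranC := calculus_range_closed archX cphi.
have ranx : range x `<=` range phi by move=> _ [i _ <-]; exists (phcproj i).
have sub : smallest (closed_sublattice e) (range x) `<=` range phi.
  exact: smallest_sub.
have ranI : range phi `<=` order_ideal e by case: ranC.
exists e; split => //.
  apply: vbigjoin_le => // i; apply: (vle_sum1 (F := fun j => vabs (x j))) => j.
  exact: vabs_ge0.
apply/(norm_completeE e0); first by move=> y /sub/ranI.
move=> u uS uC.
have [|y ry uy] := calculus_range_complete cphi (u := u) _ uC.
  by move=> k; exact: sub.
exists y => // A [AC Ax]; have [_ _ Aclosed] := AC; apply: Aclosed.
  exact: ranI.
move=> eps eps0; have [|N NP] := uy (eps / 2); first by rewrite divr_gt0.
exists (u N); first by apply: uS; split.
have eps2 : eps / 2 < eps by rewrite gtr_pMr// invf_lt1// ltr1n.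
apply: le_lt_trans eps2; apply: order_norm_le; first by rewrite divr_ge0// ltW.
by rewrite vabsB NP.
Qed.

Lemma finitely_uniformly_complete_calculus :
  finitely_uniformly_complete X -> admits_calculus X.
Proof.
move=> fuc n x n0; have [e [e0 xe cpl]] := fuc n x n0.
have xei i : vabs (x i) <= e.
  exact: le_trans (vbigjoin_ge (fun j => vabs (x j)) i) xe.
set S := smallest _ _ in cpl.
(* The ideal bounds the smallest closed sublattice from above, so that the
   latter is not a vacuous intersection. *)
have idealC : closed_sublattice e (order_ideal e).
  split => //; apply: sublattice_join.
  - by exists 0 => //; rewrite vabs0 scale0r.
  - move=> a y z [b b0 yb] [c c0 zc]; exists (`|a| * b + c).
      by rewrite addr_ge0// mulr_ge0.
    apply: le_trans (vabsD _ _) _; rewrite vabsZ scalerDl -scalerA.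
    by apply: vlerD => //; exact: vlerZ.
  - move=> y z [b b0 yb] [c c0 zc]; exists (b + c); first exact: addr_ge0.
    have yz : vabs (vjoin y z) <= vabs y + vabs z.
      by have := vjoin_dist y z 0 0; rewrite (vjoinr_id (lexx 0)) !subr0.
    by apply: le_trans yz _; rewrite scalerDl; exact: vlerD.
have SI : S `<=` order_ideal e.
  apply: smallest_sub => // _ [i _ <-]; exists 1 => //.
  by rewrite scale1r.
have SS : sublattice S.
  apply: sublattice_join => [A [[_ AS _] _]|a y z Sy Sz A AP|y z Sy Sz A AP].
  - by case: AS.
  - by case: (AP) => -[_ [_ AD _ _] _] _; apply: AD; [exact: Sy|exact: Sz].
  - by case: (AP) => -[_ [_ _ AJ _] _] _; apply: AJ; [exact: Sy|exact: Sz].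
have Sx i : S (x i) by move=> A [_]; apply; exists i.
apply: (represents_calculus archX e0 xei SS Sx).
exact/(norm_completeE e0 SI).
Qed.

End Equivalence.

Theorem theorem1p3 (R : realType) (X : vectorLatticeType R)
    (archX : archimedean X) :
  (admits_calculus X <-> finitely_uniformly_complete X) /\
  (finitely_uniformly_complete X ->
    (forall (n : nat) (x : 'I_n -> X), (0 < n)%N ->
       exists! phi : phcfun R n -> X, calculus_at x phi) /\
    (forall Phi : (forall n : nat, ('I_n -> X) -> phcfun R n -> X),
       is_calculus Phi ->
       forall (m n : nat) (x : 'I_n -> X) (f : 'I_m -> phcfun R n)
         (g : phcfun R m), (0 < m)%N -> (0 < n)%N ->
         Phi m (fun j => Phi n x (f j)) g = Phi n x (phccomp g f))).
Proof.
have fuc_cal := finitely_uniformly_complete_calculus archX.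
split; first by split; [exact: calculus_finitely_uniformly_complete|].
move=> fuc; split => [n x n0|Phi PhiP m n x f g m0 n0].
  have [phi cphi] := fuc_cal fuc n x n0.
  by exists phi; split => // psi; exact: calculus_unique.
have comp := calculus_comp f (PhiP n x n0).
by rewrite (calculus_unique archX (PhiP m _ m0) comp).
Qed.
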